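(* Let $\Gamma$ be an $n$-player extensive-form game with perfect recall. An extensive-form correlation plan $\xi\in\Xi$ is an NFCCE if and only if the following inequality holds for any player $i\in\{1,\dots,n\}$ and any sequence-form strategy $y_i\in Q_i$: $$\sum_{z\in Z}u_i(z)\,\xi_i(\varnothing_i;z)\,y_i(\sigma_i(z))\ \le\ \sum_{z\in Z}u_i(z)\,\xi_i(\sigma_i(z);z).$$
   Context: **Game.** $\Gamma$ is an $n$-player extensive-form game with perfect recall. Each non-leaf node $v$ belongs to a player $i\in\{1,\dots,n\}$ or to the chance player $\mathsf c$; $A_v$ is its set of actions. $Z$ is the set of leaves, $u_i(z)\in\mathbb R$ Player $i$'s payoff at $z$. The nodes of Player $i$ are partitioned into a collection $\mathcal I_i$ of information sets, with common action set $A_I$ at $I$. **Sequences.** $\Sigma_i=\{(I,a): I\in\mathcal I_i,a\in A_I\}\cup\{\varnothing_i\}$. For a node $v$, $\sigma_i(v)$ is the last $(I,a)\in\Sigma_i$ encountered on the path from the root to $v$, or $\varnothing_i$ if none; $\sigma_i(I)=\sigma_i(v)$ for any $v\in I\in\mathcal I_i$. Information sets $I_i\in\mathcal I_i$, $I_j\in\mathcal I_j$ are connected if there are $u\in I_i$, $v\in I_j$ such that the path from the root to $u$ passes through $v$ or vice versa. For $i\neq j$, sequences $\sigma_i\in\Sigma_i$, $\sigma_j\in\Sigma_j$ are relevant if one of them is empty or their information sets are connected. **Plans.** A reduced-normal-form plan $\pi$ of Player $i$ selects an action $\pi(I)\in A_I$ at exactly those $I\in\mathcal I_i$ reachable given its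 own other choices. $\Pi_i$ is the set of such plans; $\Pi_i(\varnothing_i)=\Pi_i$, $\Pi_i((I,a))=\Pi_i(\sigma_i(I))\cap\{\pi:\pi(I)=a\}$, and $\Pi_i(z)=\Pi_i(\sigma_i(z))$ for $z\in Z$. **Sequence-form strategies.** $Q_i\subseteq\mathbb R_{\ge0}^{\Sigma_i}$ is the set of vectors $y$ of the form $y(\sigma)=\sum_{\pi\in\Pi_i(\sigma)}\hat\mu(\pi)$ for a probability distribution $\hat\mu$ over $\Pi_i$. **Correlation plans.** A distribution $\mu$ over $\Pi_1\times\dots\times\Pi_n$ induces the vector $\xi$, indexed by tuples $(\sigma_1,\dots,\sigma_n)\in\Sigma_1\times\dots\times\Sigma_n$ of pairwise-relevant sequences, with $\xi(\sigma_1,\dots,\sigma_n)=\sum_{\pi_1\in\Pi_1(\sigma_1),\dots,\pi_n\in\Pi_n(\sigma_n)}\mu(\pi_1,\dots,\pi_n)$. $\Xi$ is the set of all such $\xi$. Write $\xi_i(\sigma;z)=\xi(\sigma_1(z),\dots,\sigma_{i-1}(z),\sigma,\sigma_{i+1}(z),\dots,\sigma_n(z))$. **NFCCE (normal-form coarse-correlated equilibrium).** $\mu$ is an NFCCE if no player can gain by unilaterally not committing to the recommended plan: for every player $i$ and every probability distribution $\hat\mu_i$ over $\Pi_i$ (independent of $\mu$), $\hat u_i\le u_i$, where the utility of deviating to $\hat\mu_i$ and the utility of committing are expressed as $$\hat u_i=\sum_{z\in Z}u_i(z)\Big(\sum_{\pi_i\in\Pi_i,\ \pi_j\in\Pi_j(z)\,\forall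 j\ne i}\mu(\pi_1,\dots,\pi_n)\Big)\Big(\sum_{\pi_i\in\Pi_i(z)}\hat\mu_i(\pi_i)\Big),\qquad u_i=\sum_{z\in Z}u_i(z)\sum_{\pi_j\in\Pi_j(z)\,\forall j}\mu(\pi_1,\dots,\pi_n).$$ A correlation plan $\xi\in\Xi$ is called an NFCCE if it is induced by some $\mu$ that is an NFCCE. *)

(* Defs.v *)
From HB Require Import structures.
From mathcomp Require Import all_boot all_order all_algebra.
Set Implicit Arguments.
Unset Strict Implicit.
Unset Printing Implicit Defensive.
Import Order.TTheory GRing.Theory Num.Theory.
Local Open Scope ring_scope.

(* A finite game tree is a finite type of nodes together with, for each node,
   the path leading to it from the root, given as the list of the pairs
   (node left, action taken there).  [hist_rcons] makes the last node on the
   path to v the parent of v, and [hist_inj] makes (parent, action) determine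
   the child. *)
Record tree (n : nat) := Tree {
  node : finType;
  act : finType;
  root : node;
  hist : node -> seq (node * act);
  hist_root : hist root = [::];
  hist_inj : injective hist;
  hist_rcons : forall v u a h, hist v = rcons h (u, a) -> h = hist u;
  (* [None] is the chance player; the owner of a leaf is irrelevant. *)
  owner : node -> option 'I_n
}.
Arguments node {n} t.
Arguments act {n} t.
Arguments root {n} t.
Arguments hist {n t} v.
Arguments owner {n t} v.

Definition actions n (T : tree n) (v : node T) : {set act T} :=
  [set a | [exists w, hist w == rcons (hist v) (v, a)]].

Definition leaves n (T : tree n) : {set node T} :=
  [set v | actions v == set0].

Definition player_nodes n (T : tree n) (i : 'I_n) : {set node T} :=
  [set v | (v \notin leaves T) && (owner v == Some i)].

(* There is no separate chance distribution: as the equilibrium conditions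
   weight a leaf z by [payoff i z] only, the probability with which chance
   plays towards z is part of [payoff i z].  The value of [payoff] at nodes
   that are not leaves is irrelevant. *)
Record game (R : realFieldType) (n : nat) := Game {
  gtree :> tree n;
  infosets : 'I_n -> {set {set node gtree}};
  infosets_partition : forall i, partition (infosets i) (player_nodes gtree i);
  infosets_actions : forall i I, I \in infosets i ->
    forall u v, u \in I -> v \in I -> actions u = actions v;
  payoff : 'I_n -> node gtree -> R
}.
Arguments infosets {R n} g i.
Arguments payoff {R n} g i z.

(* The common action set A_I: the sets [actions v], v \in I, all coincide. *)
Definition info_actions R n (G : game R n) (I : {set node G}) : {set act G} :=
  \bigcup_(v in I) actions v.

(* The (information set, action) pairs of player i met on the path to v. *)
Definition own_path R n (G : game R n) (i : 'I_n) (v : node G) :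
    seq ({set node G} * act G) :=
  [seq (pblock (infosets G i) ua.1, ua.2)
     | ua <- hist v & owner ua.1 == Some i].

Definition perfect_recall R n (G : game R n) : Prop :=
  forall i I, I \in infosets G i ->
  forall u v, u \in I -> v \in I -> own_path i u = own_path i v.

(* [None] is the empty sequence. *)
Definition is_sequence R n (G : game R n) (i : 'I_n)
    (s : option ({set node G} * act G)) : bool :=
  if s is Some (J, a) then (J \in infosets G i) && (a \in info_actions J)
  else true.

Definition sequence R n (G : game R n) (i : 'I_n) : finType :=
  {s : option ({set node G} * act G) | is_sequence i s}.

Definition empty_sequence R n (G : game R n) (i : 'I_n) : sequence G i :=
  exist _ None isT.
Arguments empty_sequence {R n} G i.

Definition last_sequence R n (G : game R n) (i : 'I_n) (v : node G) :
    option ({set node G} * act G) :=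
  last None [seq Some Ia | Ia <- own_path i v].

Lemma mem_hist n (T : tree n) (v u : node T) (a : act T) :
  (u, a) \in hist v ->
  a \in actions u /\ exists h, hist v = hist u ++ (u, a) :: h.
Proof.
have P h2 h1 w : hist w = h1 ++ (u, a) :: h2 ->
    h1 = hist u /\ exists w', hist w' = rcons h1 (u, a).
  elim/last_ind: h2 w => [|h2 [x b] IH] w.
    by rewrite cats1 => e; split; [exact: hist_rcons e | exists w].
  rewrite -rcons_cons -rcons_cat => e.
  exact: (IH x (esym (hist_rcons e))).
move=> uv; case/splitPr e : {1}(hist v) / uv => [h1 h2].
have [<- [w ew]] := P _ _ _ e; split; last by exists h2.
have [e1 _] := P _ _ _ e.
by rewrite inE; apply/existsP; exists w; rewrite ew e1.
Qed.

Lemma mem_own_path R n (G : game R n) (i : 'I_n) (v : node G) I a :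
  (I, a) \in own_path i v ->
  exists u, [/\ (u, a) \in hist v, u \in I, I \in infosets G i
              & a \in actions u].
Proof.
case/mapP => -[u b]; rewrite mem_filter /= => /andP[/eqP ou ub] [-> ->].
have [au _] := mem_hist ub.
have uD : u \in cover (infosets G i).
  rewrite (cover_partition (infosets_partition G i)) inE ou eqxx andbT.
  by rewrite inE; apply/set0Pn; exists b.
by exists u; split=> //; rewrite ?mem_pblock ?pblock_mem.
Qed.

Lemma last_sequenceP R n (G : game R n) (i : 'I_n) (v : node G) I a :
  last_sequence i v = Some (I, a) -> exists l, own_path i v = rcons l (I, a).
Proof.
rewrite /last_sequence; case/lastP: (own_path i v) => [//|l x].
by rewrite map_rcons last_rcons => -[->]; exists l.
Qed.

Lemma last_sequence_is_sequence R n (G : game R n) (i : 'I_n) (v : node G) :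
  is_sequence i (last_sequence i v).
Proof.
case e : (last_sequence i v) => [[I a]|//].
have [l el] := last_sequenceP e.
have /mem_own_path[u [_ uI Ii au]] : (I, a) \in own_path i v.
  by rewrite el mem_rcons mem_head.
by rewrite /is_sequence Ii; apply/bigcupP; exists u.
Qed.

Definition sigma R n (G : game R n) (i : 'I_n) (v : node G) : sequence G i :=
  exist _ (last_sequence i v) (last_sequence_is_sequence i v).

Definition passes_through n (T : tree n) (u v : node T) : bool :=
  v \in rcons (unzip1 (hist u)) u.

Definition connected n (T : tree n) (I J : {set node T}) : bool :=
  [exists u in I, exists v in J, passes_through u v || passes_through v u].

Definition relevant R n (G : game R n) (i j : 'I_n)
    (s : sequence G i) (t : sequence G j) : bool :=
  if (val s, val t) is (Some (J, _), Some (K, _)) then connected J K else true.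

Definition relevant_tuple R n (G : game R n)
    (s : {dffun forall i, sequence G i}) : bool :=
  [forall i, forall j, (i != j) ==> relevant (s i) (s j)].

Definition rel_tuple R n (G : game R n) : finType :=
  {s : {dffun forall i, sequence G i} | relevant_tuple s}.

(* Under perfect recall the set [own_path i v] is the same for all v \in I, so
   that [exists] may be read as [forall]. *)
Definition reaches R n (G : game R n) (i : 'I_n)
    (p : {ffun {set node G} -> option (act G)}) (I : {set node G}) : bool :=
  [exists v in I, all (fun Jb => p Jb.1 == Some Jb.2) (own_path i v)].

(* Reduced-normal-form plans, as partial maps from information sets. *)
Definition is_plan R n (G : game R n) (i : 'I_n)
    (p : {ffun {set node G} -> option (act G)}) : bool :=
  [forall I : {set node G},
     if (I \in infosets G i) && reaches i p I
     then [exists a in info_actions I, p I == Some a]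
     else p I == None].

Definition plan R n (G : game R n) (i : 'I_n) : finType :=
  {p : {ffun {set node G} -> option (act G)} | is_plan i p}.

(* The recursion Pi((I, a)) = Pi(sigma(I)) \cap {p | p(I) = a}, unfolded;
   see [plans_rec]. *)
Definition plans R n (G : game R n) (i : 'I_n) (s : sequence G i) :
    {set plan G i} :=
  if val s is Some (J, a)
  then [set p : plan G i | reaches i (val p) J && (val p J == Some a)]
  else setT.

Lemma plans_rec R n (G : game R n) (i : 'I_n) (s : sequence G i) I a v :
  perfect_recall G -> val s = Some (I, a) -> v \in I ->
  plans s = plans (sigma i v) :&: [set p : plan G i | val p I == Some a].
Proof.
move=> PR es vI; have := valP s; rewrite es => /andP[Ii _].
apply/setP => p; rewrite /plans es !inE.
have [pI|_] := boolP (val p I == Some a); last by rewrite !andbF.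
rewrite !andbT; have /forallP/(_ I) := valP p; rewrite Ii /=.
case: ifP => [rI _|_ /eqP e]; last by rewrite e in pI.
apply/esym; case e : (last_sequence i v) => [[J b]|]; last by rewrite inE.
have [l el] := last_sequenceP e.
have /existsP[w /andP[wI]] := rI; rewrite (PR i I Ii w v wI vI) el all_rcons.
case/andP=> /= pJ allp; rewrite inE pJ andbT.
have Jb : (J, b) \in own_path i v by rewrite el mem_rcons mem_head.
have [u [uv uJ Ji _]] := mem_own_path Jb.
apply/existsP; exists u; rewrite uJ /=.
have [_ [h ev]] := mem_hist uv.
apply/allP => x xu; have : x \in own_path i v.
  case/mapP: xu => y; rewrite mem_filter => /andP[oy yu] ->; apply: map_f.
  by rewrite mem_filter oy ev mem_cat yu.
by rewrite el mem_rcons inE => /orP[/eqP -> //|/(allP allp)].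
Qed.

Definition is_distr (R : realFieldType) (T : finType) (mu : {ffun T -> R}) :
    Prop :=
  (forall x, 0 <= mu x) /\ \sum_x mu x = 1.

Definition Q R n (G : game R n) (i : 'I_n) (y : {ffun sequence G i -> R}) :
    Prop :=
  exists2 mu : {ffun plan G i -> R},
    is_distr mu & forall s, y s = \sum_(p in plans s) mu p.

Definition joint_plan R n (G : game R n) : finType :=
  {dffun forall i, plan G i}.

Definition induces R n (G : game R n)
    (mu : {ffun joint_plan G -> R}) (xi : {ffun rel_tuple G -> R}) : Prop :=
  forall s : rel_tuple G,
    xi s = \sum_(p : joint_plan G | [forall i, p i \in plans (val s i)]) mu p.

Definition Xi R n (G : game R n) (xi : {ffun rel_tuple G -> R}) : Prop :=
  exists2 mu, is_distr mu & induces mu xi.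

Definition leaf_tuple R n (G : game R n) (i : 'I_n) (s : sequence G i)
    (z : node G) : {dffun forall j, sequence G j} :=
  finfun (dfwith (fun j => sigma j z) s).

(* xi_i(s; z).  The value 0 is taken only if the tuple is not relevant, which
   does not occur for the sequences of interest; see [leaf_tuple_sigma] and
   [leaf_tuple_empty]. *)
Definition xi_at R n (G : game R n) (xi : {ffun rel_tuple G -> R}) (i : 'I_n)
    (s : sequence G i) (z : node G) : R :=
  oapp xi 0 (insub (leaf_tuple s z)).

Lemma passes_hist n (T : tree n) (z u v : node T) a b :
  (u, a) \in hist z -> (v, b) \in hist z ->
  passes_through u v || passes_through v u.
Proof.
move=> uz vz; have [_ [h e]] := mem_hist uz; have [_ [h' e']] := mem_hist vz.
wlog le : u v a b uz vz h e h' e' / (size (hist u) <= size (hist v))%N.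
  move=> W; case: (leqP (size (hist u)) (size (hist v))) => [|/ltnW] le.
    exact: W uz vz h e h' e' le.
  by rewrite orbC; exact: W vz uz h' e' h e le.
rewrite /passes_through !mem_rcons !inE.
have := congr1 (fun x => nth (u, a) x (size (hist u))) (etrans (esym e) e').
rewrite !nth_cat ltnn subnn /=; case: ltnP => [lt ua|ge].
  have uv : u \in unzip1 (hist v).
    by apply/mapP; exists (u, a); rewrite // ua mem_nth.
  by rewrite uv !orbT.
have -> : (size (hist u) - size (hist v) = 0)%N by apply/eqP; rewrite subn_eq0.
by move=> [-> _]; rewrite eqxx.
Qed.

Lemma relevant_sigma R n (G : game R n) (i j : 'I_n) (z : node G) :
  relevant (sigma i z) (sigma j z).
Proof.
rewrite /relevant /=.
case ei : (last_sequence i z) => [[I a]|//].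
case ej : (last_sequence j z) => [[J b]|//].
have [l el] := last_sequenceP ei; have [l' el'] := last_sequenceP ej.
have /mem_own_path[u [uz uI _ _]] : (I, a) \in own_path i z.
  by rewrite el mem_rcons mem_head.
have /mem_own_path[v [vz vJ _ _]] : (J, b) \in own_path j z.
  by rewrite el' mem_rcons mem_head.
apply/existsP; exists u; rewrite uI; apply/existsP; exists v; rewrite vJ /=.
exact: passes_hist uz vz.
Qed.

Lemma leaf_tuple_sigma R n (G : game R n) (i : 'I_n) (z : node G) :
  relevant_tuple (leaf_tuple (sigma i z) z).
Proof.
apply/forallP => j; apply/forallP => k; apply/implyP => _; rewrite !ffunE.
by case: dfwithP => [|? _]; case: dfwithP => [|? _]; apply: relevant_sigma.
Qed.

Lemma leaf_tuple_empty R n (G : game R n) (i : 'I_n) (z : node G) :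
  relevant_tuple (leaf_tuple (empty_sequence G i) z).
Proof.
apply/forallP => j; apply/forallP => k; apply/implyP => _; rewrite !ffunE.
case: dfwithP => [//|j' _]; case: dfwithP => [|k' _].
  by rewrite /relevant /=; case: last_sequence => [[]|].
exact: relevant_sigma.
Qed.

Definition utility R n (G : game R n) (mu : {ffun joint_plan G -> R})
    (i : 'I_n) : R :=
  \sum_(z in leaves G) payoff G i z *
    \sum_(p : joint_plan G | [forall j, p j \in plans (sigma j z)]) mu p.

Definition dev_utility R n (G : game R n) (mu : {ffun joint_plan G -> R})
    (i : 'I_n) (mu' : {ffun plan G i -> R}) : R :=
  \sum_(z in leaves G) payoff G i z *
    (\sum_(p : joint_plan G |
        [forall j, (j != i) ==> (p j \in plans (sigma j z))]) mu p) *
    (\sum_(p in plans (sigma i z)) mu' p).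

Definition distr_NFCCE R n (G : game R n) (mu : {ffun joint_plan G -> R}) :
    Prop :=
  forall (i : 'I_n) (mu' : {ffun plan G i -> R}),
    is_distr mu' -> dev_utility mu mu' <= utility mu i.

Definition NFCCE R n (G : game R n) (xi : {ffun rel_tuple G -> R}) : Prop :=
  exists mu, [/\ is_distr mu, induces mu xi & distr_NFCCE mu].

(* Main.v *)
(** If [mu] induces [xi], the leaf probabilities appearing in the utilities of
    committing and of deviating are coordinates of [xi]: fixing
    [sigma_j(z)] for [j != i], the coordinate [sigma_i(z)] gives the former and
    the empty sequence, which leaves the plan of player [i] free, the latter.
    So whether [mu] is an NFCCE depends on [xi] only, and [Q_i] is
    the set of marginals [y] of the distributions deviated to. *)
Require Import Defs.
From mathcomp Require Import all_boot all_order all_algebra.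
Import Order.TTheory GRing.Theory Num.Theory.
Local Open Scope ring_scope.

Section InducedPlan.

Context {R : realFieldType} {n : nat} {G : game R n}.
Context {mu : {ffun joint_plan G -> R}} {xi : {ffun rel_tuple G -> R}}.
Hypothesis mu_xi : induces mu xi.

(** Relevance rules out the default value 0 of [xi_at]; the constraint at [i] is then split off from
    those at the other players. *)
Lemma xi_at_induces (i : 'I_n) (s : sequence G i) (z : node G) :
  relevant_tuple (leaf_tuple s z) ->
  xi_at xi s z = \sum_(p : joint_plan G | (p i \in plans s) &&
    [forall j, (j != i) ==> (p j \in plans (sigma j z))]) mu p.
Proof.
move=> rel; rewrite /xi_at insubT /= mu_xi; apply: eq_bigl => p /=.
apply/forallP/andP => [H|[pi /forallP H] j].
  split; first by have := H i; rewrite ffunE dfwith_in.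
  apply/forallP => j; apply/implyP => ji.
  by have := H j; rewrite ffunE dfwith_out // eq_sym.
rewrite ffunE; case: dfwithP => // k ik.
by apply: (implyP (H k)); rewrite eq_sym.
Qed.

Lemma utility_induces (i : 'I_n) :
  utility mu i =
  \sum_(z in leaves G) payoff G i z * xi_at xi (sigma i z) z.
Proof.
apply: eq_bigr => z _; rewrite xi_at_induces ?leaf_tuple_sigma //.
congr (_ * _); apply: eq_bigl => p; apply/forallP/andP => [H|[pi /forallP H] j].
  by split=> //; apply/forallP => j; rewrite H implybT.
by have [->|ji] := eqVneq j i; last exact: (implyP (H j)).
Qed.

Lemma dev_utility_induces (i : 'I_n) (mu' : {ffun plan G i -> R}) :
  dev_utility mu mu' =
  \sum_(z in leaves G) payoff G i z * xi_at xi (empty_sequence G i) z *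
    \sum_(p in plans (sigma i z)) mu' p.
Proof.
apply: eq_bigr => z _; rewrite xi_at_induces ?leaf_tuple_empty //.
(* [plans] of the empty sequence is the full set, so [p i] is unconstrained. *)
by congr (_ * _ * _); apply: eq_bigl => p; rewrite in_setT.
Qed.

End InducedPlan.

Theorem proposition1 (R : realFieldType) (n : nat) (G : game R n)
    (hG : perfect_recall G) (xi : {ffun rel_tuple G -> R}) (hxi : Xi xi) :
  NFCCE xi <->
  (forall (i : 'I_n) (y : {ffun sequence G i -> R}), Q y ->
     \sum_(z in leaves G)
        payoff G i z * xi_at xi (empty_sequence G i) z * y (sigma i z) <=
     \sum_(z in leaves G) payoff G i z * xi_at xi (sigma i z) z).
Proof.
split=> [[mu [_ mu_xi eq_mu]] i y [mu' distr_mu' yE]|ineq].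
  rewrite -(utility_induces mu_xi); apply: le_trans (eq_mu i mu' distr_mu').
  rewrite (dev_utility_induces mu_xi).
  by under eq_bigr => z _ do rewrite yE.
(* Any [mu] inducing [xi] can serve as witness, since [xi] determines both utilities. *)
have [mu distr_mu mu_xi] := hxi; exists mu; split=> // i mu' distr_mu'.
rewrite (utility_induces mu_xi) (dev_utility_induces mu_xi).
pose y : {ffun sequence G i -> R} := [ffun s => \sum_(p in plans s) mu' p].
have Qy : Q y by exists mu' => // s; rewrite ffunE.
by have := ineq i y Qy; under eq_bigr => z _ do rewrite ffunE.
Qed.
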